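(* Let $\mathcal X$ be a zero-nonzero pattern, and let $\mathcal X'$ be obtained from $\mathcal X$ by appending one row. Then $\operatorname{mr}\mathcal R(\mathcal X)\le \operatorname{mr}\mathcal R(\mathcal X')\le \operatorname{mr}\mathcal R(\mathcal X)+1$.
   Context: A zero-nonzero pattern is a matrix with entries in $\{0,*\}$; for a pattern with $n$ columns, columns are labeled $1,\dots,n$, and the zero set of a row is the set of column labels where that row has entry $0$. For a pattern $\mathcal X$ with $n$ columns, $\mathcal R(\mathcal X)$ denotes the set of all matroids $M$ on ground set $\{1,\dots,n\}$ such that the zero set of each row of $\mathcal X$ is a flat of $M$. For a collection $\mathcal C$ of objects having a nonnegative integer rank, $\operatorname{mr}\mathcal C$ denotes the smallest rank of an object in $\mathcal C$; $\operatorname{mr}\mathcal R(\mathcal X)$ is called the matroid minimum rank of $\mathcal X$. *)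

(* Defs.v *)
From HB Require Import structures.
From mathcomp Require Import all_boot all_order all_algebra.

Set Implicit Arguments.
Unset Strict Implicit.
Unset Printing Implicit Defensive.

Section Matroid.
Variable T : finType.

Definition matroid_axiom (I : {set {set T}}) : bool :=
  [&& set0 \in I,
      [forall A : {set T}, forall B : {set T},
         (A \subset B) ==> (B \in I) ==> (A \in I)]
    & [forall A : {set T} in I, forall B : {set T} in I,
         (#|A| < #|B|) ==> [exists x in B :\: A, x |: A \in I]]].

Record matroid := Matroid {
  indep :> {set {set T}};
  indepP : matroid_axiom indep
}.

HB.instance Definition _ := [isSub for indep].
HB.instance Definition _ := [Finite of matroid by <:].

Definition rank_of (M : matroid) (A : {set T}) : nat :=
  \max_(I in indep M | I \subset A) #|I|.

Definition mrank (M : matroid) : nat := rank_of M [set: T].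

Definition cl (M : matroid) (A : {set T}) : {set T} :=
  [set x | rank_of M (x |: A) == rank_of M A].

Definition flat (M : matroid) (F : {set T}) : bool := cl M F == F.

Lemma free_matroid_axiom : matroid_axiom [set: {set T}].
Proof.
apply/and3P; split; first by rewrite inE.
  by apply/forallP=> A; apply/forallP=> B; rewrite !inE !implybT.
apply/forall_inP=> A _; apply/forall_inP=> B _; apply/implyP=> ltAB.
have /set0Pn[x xBA] : B :\: A != set0.
  by rewrite setD_eq0; apply: contraL ltAB => /subset_leq_card; rewrite -leqNgt.
by apply/exists_inP; exists x => //; rewrite inE.
Qed.

Definition free_matroid : matroid := Matroid free_matroid_axiom.

Lemma rank_of_free A : rank_of free_matroid A = #|A|.
Proof.
apply/eqP; rewrite eqn_leq; apply/andP; split.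
  by apply/bigmax_leqP=> I /andP[_ /subset_leq_card].
by apply: (bigmax_sup A); rewrite ?inE ?subxx.
Qed.

Lemma flat_free A : flat free_matroid A.
Proof.
apply/eqP/setP=> x; rewrite inE !rank_of_free cardsU1.
by case: (x \in A); rewrite ?eqxx //= add1n eqn_leq ltnn.
Qed.

End Matroid.

Section MinimumRank.
Variables (T : finType) (rk : T -> nat) (C : {set T}).

Lemma mr_subproof : C != set0 -> exists k, [exists M in C, rk M == k].
Proof. by case/set0Pn=> M MC; exists (rk M); apply/exists_inP; exists M. Qed.

Definition mr (C0 : C != set0) : nat := ex_minn (mr_subproof C0).

End MinimumRank.

(* A zero-nonzero pattern is a boolean matrix, with false for 0 and true
   for *; the column labels 1, ..., n are represented by 'I_n. *)
Definition pattern (m n : nat) := 'M[bool]_(m, n).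

Definition zero_set m n (X : pattern m n) (i : 'I_m) : {set 'I_n} :=
  [set j | ~~ X i j].

Definition matroids_of m n (X : pattern m n) : {set matroid 'I_n} :=
  [set M | [forall i, flat M (zero_set X i)]].

(* The free matroid belongs to R(X), so the minimum is always attained. *)
Lemma matroids_of_neq0 m n (X : pattern m n) : matroids_of X != set0.
Proof.
apply/set0Pn; exists (free_matroid 'I_n); rewrite inE.
by apply/forallP=> i; apply: flat_free.
Qed.

Definition matroid_min_rank m n (X : pattern m n) : nat :=
  mr (@mrank 'I_n) (matroids_of_neq0 X).

Definition append_row m n (X : pattern m n) (r : 'rV[bool]_n) :
  pattern (m + 1) n := col_mx X r.

(* Main.v *)
(** The lower bound holds because R(X') is contained in R(X). For the upper
    bound, take M in R(X) and let Z be the zero set of the new row. The lift of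
    M by Z (the matroid union of M with the rank-one matroid whose loops are
    exactly Z) has rank at most one more than M, has Z as a flat, and keeps
    every flat of M. Flats are handled through independent sets: F is a flat
    iff adding any element outside F to an independent subset of F keeps it
    independent. *)

Require Import Defs.
From mathcomp Require Import all_boot all_order all_algebra.

Set Implicit Arguments.
Unset Strict Implicit.
Unset Printing Implicit Defensive.

Section Matroid.
Variable T : finType.
Implicit Types (M : matroid T) (A B F J Z : {set T}) (x y : T).

Lemma setU1D1_sub x y A : (x |: A) :\ y \subset x |: (A :\ y).
Proof.
by apply/subsetP=> z; rewrite !inE; case/andP=> -> /orP[-> | ->]; rewrite ?orbT.
Qed.

Lemma indep_sub M A B : A \subset B -> B \in indep M -> A \in indep M.
Proof.
by case/and3P: (indepP M) => _ /forallP/(_ A)/forallP/(_ B)/implyP sub _ AB;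
  exact/implyP/sub.
Qed.

Lemma indep_exchange M A B : A \in indep M -> B \in indep M -> #|A| < #|B| ->
  exists x, [/\ x \in B, x \notin A & x |: A \in indep M].
Proof.
case/and3P: (indepP M) => _ _ /forall_inP exch AM BM ltAB.
move/forall_inP/(_ B BM)/implyP/(_ ltAB)/exists_inP: (exch A AM).
by case=> x; rewrite inE => /andP[xA xB] xAM; exists x.
Qed.

Lemma leq_rank_of M A J : J \in indep M -> J \subset A -> #|J| <= rank_of M A.
Proof. by move=> JM JA; apply: (bigmax_sup J); rewrite ?JM. Qed.

(** Take a largest independent set between [J] and [A]: were some independent subset of [A] larger,
    exchange would enlarge it. *)
Lemma indep_basis M A J : J \in indep M -> J \subset A ->
  exists B, [/\ J \subset B, B \subset A, B \in indep M & #|B| = rank_of M A].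
Proof.
move=> JM JA.
pose P B := [&& J \subset B, B \subset A & B \in indep M].
have PJ : P J by rewrite /P subxx JA.
case: (arg_maxnP (fun B => #|B|) PJ) => B /and3P[JB BA BM] maxB.
exists B; split=> //; apply/eqP; rewrite eqn_leq leq_rank_of //=.
apply/bigmax_leqP=> K /andP[KM KA]; rewrite leqNgt; apply/negP=> ltBK.
have [x [xK xB xBM]] := indep_exchange BM KM ltBK.
have := maxB (x |: B); rewrite /P xBM subUset sub1set (subsetP KA) // BA.
rewrite (subset_trans JB (subsetUr _ _)) cardsU1 xB /= => /(_ isT).
by rewrite add1n ltnn.
Qed.

Lemma flatP M F :
  reflect (forall x J, x \notin F -> J \subset F -> J \in indep M ->
             x |: J \in indep M)
          (flat M F).
Proof.
apply: (iffP eqP) => [clF x J xF JF JM | ext].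
  have [B [JB BF BM cardB]] := indep_basis JM JF.
  have [K [_ KF KM cardK]] := indep_basis BM (subset_trans BF (subsetUr [set x] F)).
  have ltBK : #|B| < #|K|.
    have xcl : x \notin cl M F by rewrite clF.
    rewrite ltn_neqAle cardB cardK -{2}cardB leq_rank_of //.
      by rewrite eq_sym andbT; move: xcl; rewrite inE.
    exact: subset_trans BF (subsetUr _ _).
  have [z [zK zB zBM]] := indep_exchange BM KM ltBK.
  (* An element [z] of [F] would make [z |: B] an independent subset of [F] larger than the rank of
     [F]. *)
  have zx : z = x.
    have /setU1P[-> // | zF] := subsetP KF _ zK.
    have := leq_rank_of zBM (_ : _ \subset F).
    by rewrite subUset sub1set zF BF cardsU1 zB -cardB add1n ltnn => /(_ isT).
  by rewrite -zx; apply: indep_sub (setUS _ JB) zBM.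
apply/setP=> x; rewrite inE; have [xF | xF] := boolP (x \in F).
  by rewrite (setUidPr _) ?sub1set ?eqxx.
have M0 : set0 \in indep M by case/and3P: (indepP M).
have [B [_ BF BM cardB]] := indep_basis M0 (sub0set F).
have xB : x \notin B by apply: contra xF; apply: subsetP.
(* Adding [x] to a basis of [F] raises the rank, so [x] is outside the closure. *)
have := leq_rank_of (ext _ _ xF BF BM) (setUS [set x] BF).
by rewrite cardsU1 xB cardB add1n ltn_neqAle eq_sym => /andP[/negPf].
Qed.

(** Independent sets of the matroid union: the rank-one matroid contributes either nothing or a
    single non-loop [y], and the rest is independent in [M]. *)
Definition lift_indep M Z : {set {set T}} :=
  [set A | (A \in indep M) || [exists y in A :\: Z, A :\ y \in indep M]].

Lemma lift_indepP M Z A :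
  reflect (A \in indep M \/
           exists y, [/\ y \in A, y \notin Z & A :\ y \in indep M])
          (A \in lift_indep M Z).
Proof.
rewrite inE; apply: (iffP orP) => -[AM | ]; [by left | | by left | ].
  by case/exists_inP=> y /setDP[yA yZ] AyM; right; exists y.
by case=> y [yA yZ AyM]; right; apply/exists_inP; exists y => //; rewrite inE yZ.
Qed.

(** Let [t] be the non-loop removed from [B]. If [t] is not in [A], it can be added as the non-loop
    of the new set. Otherwise remove [t] from both sets, exchange in [M], and put [t] back as the
    non-loop. *)
Lemma lift_indep_exchange M Z A B :
  A \in indep M -> B \in lift_indep M Z -> #|A| < #|B| ->
  exists2 x, x \in B :\: A & x |: A \in lift_indep M Z.
Proof.
move=> AM BL ltAB; have [BM | [t [tB tZ BtM]]] := lift_indepP _ _ _ BL.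
  have [x [xB xA xAM]] := indep_exchange AM BM ltAB.
  by exists x; [rewrite inE xA | apply/lift_indepP; left].
have [tA | tA] := boolP (t \in A); last first.
  exists t; first by rewrite inE tA.
  by apply/lift_indepP; right; exists t; rewrite setU11 setU1K.
have AtM : A :\ t \in indep M by apply: indep_sub AM; apply: subsetDl.
have ltAtBt : #|A :\ t| < #|B :\ t|.
  by move: ltAB; rewrite (cardsD1 t A) (cardsD1 t B) tA tB ltn_add2l.
have [x [/setD1P[xt xB] xAt xAtM]] := indep_exchange AtM BtM ltAtBt.
have xA : x \notin A by move: xAt; rewrite !inE xt.
exists x; first by rewrite inE xA.
apply/lift_indepP; right; exists t; split=> //; first by rewrite inE tA orbT.
exact: indep_sub (setU1D1_sub _ _ _) xAtM.
Qed.

Lemma lift_matroid_axiom M Z : matroid_axiom (lift_indep M Z).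
Proof.
apply/and3P; split.
- by apply/lift_indepP; left; case/and3P: (indepP M).
- apply/forallP=> A; apply/forallP=> B; apply/implyP=> AB; apply/implyP.
  case/lift_indepP=> [BM | [y [yB yZ ByM]]].
    by apply/lift_indepP; left; apply: indep_sub BM.
  apply/lift_indepP; have [yA | yA] := boolP (y \in A).
    by right; exists y; split=> //; apply: indep_sub ByM; apply: setSD.
  by left; apply: indep_sub ByM; rewrite subsetD1 AB.
apply/forall_inP=> A AL; apply/forall_inP=> B BL; apply/implyP=> ltAB.
apply/exists_inP; have [AM | nAM] := boolP (A \in indep M).
  exact: lift_indep_exchange ltAB.
have [AM | [y [yA yZ AyM]]] := lift_indepP _ _ _ AL; first by rewrite AM in nAM.
(* [C] is [B] itself or [B] without its non-loop; exchange in [M] is then applied to [A :\ y] and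
   [C]. *)
have [C [CM CB ltAyC]] :
    exists C, [/\ C \in indep M, C \subset B & #|A :\ y| < #|C|].
  have leAyA : #|A :\ y| < #|A| by rewrite [ltnRHS](cardsD1 y) yA.
  have [BM | [t [tB tZ BtM]]] := lift_indepP _ _ _ BL.
    by exists B; split=> //; apply: ltn_trans ltAB.
  exists (B :\ t); split; rewrite ?subsetDl //.
  by move: ltAB; rewrite (cardsD1 y A) (cardsD1 t B) yA tB ltn_add2l.
have [x [xC xAy xAyM]] := indep_exchange AyM CM ltAyC.
(* If [x] were [y], the exchange would give back [A], which is dependent in [M]. *)
have xy : x != y by apply: contraNneq nAM => xy; rewrite -(setD1K yA) -{1}xy.
have xA : x \notin A by move: xAy; rewrite !inE xy.
exists x; first by rewrite inE xA (subsetP CB).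
apply/lift_indepP; right; exists y; split=> //; first by rewrite inE yA orbT.
exact: indep_sub (setU1D1_sub _ _ _) xAyM.
Qed.

Definition lift_matroid M Z : matroid T := Matroid (lift_matroid_axiom M Z).

(** A subset of [Z] has no non-loop to remove, so it is independent in [M]; the added [x] outside
    [Z] then serves as the non-loop. *)
Lemma flat_lift_base M Z : flat (lift_matroid M Z) Z.
Proof.
apply/flatP=> x J xZ JZ /lift_indepP[JM | [y [yJ]]]; last first.
  by rewrite (subsetP JZ).
have xJ : x \notin J by apply: contra xZ; apply: subsetP.
by apply/lift_indepP; right; exists x; rewrite setU11 setU1K.
Qed.

(** The non-loop [y] of [J] is kept for [x |: J], while flatness in [M] adds [x] to [J :\ y]. *)
Lemma flat_lift M Z F : flat M F -> flat (lift_matroid M Z) F.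
Proof.
move/flatP=> extF; apply/flatP=> x J xF JF.
case/lift_indepP=> [JM | [y [yJ yZ JyM]]]; apply/lift_indepP.
  by left; apply: extF.
right; exists y; split=> //; first by rewrite inE yJ orbT.
apply: indep_sub (setU1D1_sub _ _ _) _.
exact: extF (subset_trans (subsetDl _ _) JF) JyM.
Qed.

Lemma mrank_lift M Z : mrank (lift_matroid M Z) <= mrank M + 1.
Proof.
apply/bigmax_leqP=> J /andP[/lift_indepP[JM | [y [yJ _ JyM]]] _].
  by apply: leq_trans (leq_rank_of JM (subsetT _)) (leq_addr _ _).
by rewrite (cardsD1 y) yJ addnC leq_add2r leq_rank_of ?subsetT.
Qed.

End Matroid.

Section MinimumRank.
Variables (T : finType) (rk : T -> nat) (C : {set T}) (C0 : C != set0).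

Lemma mr_attained : exists2 x, x \in C & rk x = mr rk C0.
Proof.
by rewrite /mr; case: ex_minnP => k /exists_inP[x xC /eqP xk] _; exists x.
Qed.

Lemma mr_le x : x \in C -> mr rk C0 <= rk x.
Proof.
rewrite /mr; case: ex_minnP => k _ min_k xC.
by apply: min_k; apply/exists_inP; exists x.
Qed.

End MinimumRank.

Lemma matroids_of_append_row m n (X : pattern m n) (r : 'rV[bool]_n) M :
  (M \in matroids_of (append_row X r)) =
  (M \in matroids_of X) && flat M (zero_set r ord0).
Proof.
have zeroX i : zero_set (append_row X r) (lshift 1 i) = zero_set X i.
  by apply/setP=> j; rewrite !inE col_mxEu.
have zeror i : zero_set (append_row X r) (rshift m i) = zero_set r i.
  by apply/setP=> j; rewrite !inE col_mxEd.
rewrite !inE; apply/forallP/andP => [flatX' | [/forallP flatX flatr] i].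
  split; last by rewrite -zeror.
  by apply/forallP=> i; rewrite -zeroX.
by case: (split_ordP i) => k ->; rewrite ?zeroX ?zeror // (ord1 k).
Qed.

Theorem theorem3p8 (m n : nat) (X : pattern m n) (r : 'rV[bool]_n) :
  matroid_min_rank X <= matroid_min_rank (append_row X r)
                     <= matroid_min_rank X + 1.
Proof.
apply/andP; split.
  have [M] := mr_attained (@mrank 'I_n) (matroids_of_neq0 (append_row X r)).
  rewrite matroids_of_append_row => /andP[MX _] rkM.
  by rewrite {2}/matroid_min_rank -rkM mr_le.
have [M MX rkM] := mr_attained (@mrank 'I_n) (matroids_of_neq0 X).
rewrite {2}/matroid_min_rank -rkM.
(* The witness for the extended pattern is the lift of a minimizer [M] by the zero set of the new
   row. *)
apply: leq_trans (mrank_lift M (zero_set r ord0)).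
apply: mr_le; rewrite matroids_of_append_row flat_lift_base andbT.
move: MX; rewrite !inE => /forallP flatX.
by apply/forallP=> i; apply: flat_lift.
Qed.
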